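(* Let $p\le q$ be fixed natural numbers and let $n$ be a natural number. If $n\le q$, then $v_{p,q}(n)=u_p(n)$. Otherwise $n>q$ and $$v_{p,q}(n)=\sum_{k=p}^{q}v_{p,q}(n-k).$$
   Context: Natural numbers are positive integers. A composition of a natural number $n$ is an ordered finite sequence $(a_1,\dots,a_k)$, $k\ge 1$, of natural numbers (called its parts) with $n=a_1+a_2+\cdots+a_k$; sequences differing in order are different compositions. For natural numbers $p$ and $n$, $u_p(n)$ denotes the number of compositions of $n$ all of whose parts are greater than or equal to $p$. For natural numbers $p\le q$ and $n$, $v_{p,q}(n)$ denotes the number of compositions of $n$ all of whose parts $a$ satisfy $p\le a\le q$. *)

(* Defs.v *)
From HB Require Import structures.
From mathcomp Require Import all_boot.

Set Implicit Arguments.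
Unset Strict Implicit.
Unset Printing Implicit Defensive.

(* Natural numbers are positive in the source, whence the positivity of the
   parts. *)
Definition is_composition (n : nat) (s : seq nat) : bool :=
  [&& s != [::], all (fun a => 0 < a) s & sumn s == n].

Record composition (n : nat) := Composition {
  parts :> seq nat;
  _ : is_composition n parts
}.

HB.instance Definition _ n := [isSub for @parts n].
HB.instance Definition _ n := [Equality of composition n by <:].
HB.instance Definition _ n := [Choice of composition n by <:].
HB.instance Definition _ n := [Countable of composition n by <:].

(* Finiteness: a composition of n has at most n parts, each at most n. *)
Definition bseq_of_composition n (c : composition n) : n.-bseq 'I_n.+1 :=
  insub_bseq n [seq inord a | a <- c].

Definition composition_of_bseq n (b : n.-bseq 'I_n.+1) : option (composition n) :=
  insub [seq val i | i <- b].

Lemma size_composition n (c : composition n) : size c <= n.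
Proof.
case: c => s /= /and3P[_ s_gt0 /eqP <-].
by elim: s s_gt0 => //= a s IHs /andP[a_gt0 /IHs]; rewrite -add1n; apply: leq_add.
Qed.

Lemma leq_composition n (c : composition n) a : a \in parts c -> a <= n.
Proof.
case: c => s /= /and3P[_ _ /eqP <-].
elim: s => //= b s IHs; rewrite inE => /predU1P[-> | /IHs le_as].
  exact: leq_addr.
exact: leq_trans le_as (leq_addl _ _).
Qed.

Lemma bseq_of_compositionK n :
  pcancel (@bseq_of_composition n) (@composition_of_bseq n).
Proof.
move=> c; rewrite /composition_of_bseq /bseq_of_composition.
set t := [seq inord _ | _ <- _]; have le_t : size t <= n.
  by rewrite size_map size_composition.
have -> : insub_bseq n t = t :> seq _ by exact: insubdK.
suff -> : [seq val i | i <- t] = parts c by exact: valK.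
rewrite -map_comp map_id_in // => a /leq_composition le_an /=.
by rewrite inordK.
Qed.

HB.instance Definition _ n : isFinite (composition n) :=
  PCanIsFinite (@bseq_of_compositionK n).

Definition u (p n : nat) : nat :=
  #|[set c : composition n | all (fun a => p <= a) c]|.

Definition v (p q n : nat) : nat :=
  #|[set c : composition n | all (fun a => p <= a <= q) c]|.

(* Main.v *)
(* Removing the first part k of a composition of n > q with parts in [p, q]
   leaves a composition of n - k; it is nonempty because k <= q < n. *)
Require Import Defs.
From mathcomp Require Import all_boot.

(** If [n <= q], the upper bound on the parts is automatic, as no part exceeds [n]. If [q < n],
    sorting by the first part [k] matches the compositions of [n] with pairs of some [k] in [[p, q]]
    and a composition of [n - k] ([cons_mem_compositions]); comparing the sizes of two
    duplicate-free lists gives the sum. The lists hold plain sequences, so that different totals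
    share one type. *)

Definition compositions (n : nat) (P : pred (seq nat)) : seq (seq nat) :=
  [seq parts c | c in [set c : composition n | P c]].

Lemma size_compositions n P :
  size (compositions n P) = #|[set c : composition n | P c]|.
Proof. exact: size_image. Qed.

Lemma compositions_uniq n P : uniq (compositions n P).
Proof. by rewrite map_inj_uniq ?enum_uniq //; exact: val_inj. Qed.

Lemma mem_compositions n P s :
  (s \in compositions n P) = is_composition n s && P s.
Proof.
apply/imageP/andP => [[c + ->]|[cs Ps]]; first by rewrite inE; case: c.
by exists (Composition cs); rewrite ?inE.
Qed.

Lemma cons_is_composition n k s :
  0 < k < n -> is_composition n (k :: s) = is_composition (n - k) s.
Proof.
case/andP=> k_gt0 lt_kn; rewrite /is_composition /= k_gt0 /=.
have -> : (k + sumn s == n) = (sumn s == n - k).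
  by rewrite -(eqn_add2l k (sumn s)) subnKC // ltnW.
(* Only the empty tail could tell the sides apart: its sum 0 is not [n - k], since [k < n]. *)
by case: s => //=; rewrite eq_sym subn_eq0 leqNgt lt_kn.
Qed.

Lemma cons_mem_compositions n p q k s : 0 < p -> q < n ->
  (k :: s \in compositions n (all (fun a => p <= a <= q))) =
  (p <= k <= q) && (s \in compositions (n - k) (all (fun a => p <= a <= q))).
Proof.
move=> p_gt0 lt_qn; rewrite !mem_compositions /= andbCA.
case: (boolP (p <= k <= q)) => //= /andP[le_pk le_kq].
by rewrite cons_is_composition // (leq_trans p_gt0) // (leq_ltn_trans le_kq).
Qed.

Theorem theorem10 (p q n : nat) (hp : 0 < p) (hpq : p <= q) (hn : 0 < n) :
  (n <= q -> v p q n = u p n) /\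
  (q < n -> v p q n = \sum_(p <= k < q.+1) v p q (n - k)).
Proof.
split=> [le_nq | lt_qn].
  rewrite /v /u; apply: eq_card => c; rewrite !inE.
  apply: eq_in_all => a /leq_composition le_an.
  by rewrite (leq_trans le_an) // andbT.
pose cs m := compositions m (all (fun a => p <= a <= q)).
have size_cs m : size (cs m) = v p q m by exact: size_compositions.
pose t := [seq k :: s | k <- index_iota p q.+1, s <- cs (n - k)].
have t_uniq : uniq t.
  apply: allpairs_uniq_dep => [|k _|]; rewrite ?iota_uniq ?compositions_uniq //.
  by move=> [k s] [k' s'] _ _ /= [-> ->].
have cs_t : cs n =i t.
  move=> [|k s].
    (* The empty sequence is no composition, and every entry of [t] has a first part. *)
    by rewrite mem_compositions; apply/esym/allpairsPdep => -[k [s []]].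
  rewrite cons_mem_compositions //.
  apply/andP/allpairsPdep => [[k_pq s_cs] | [k' [s' [+ s_cs [-> ->]]]]].
    by exists k, s; rewrite mem_index_iota ltnS.
  by rewrite mem_index_iota ltnS.
rewrite -size_cs (perm_size (uniq_perm (compositions_uniq _ _) t_uniq cs_t)).
rewrite size_allpairs_dep sumnE big_map.
by apply: eq_bigr => k _; rewrite size_cs.
Qed.
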